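(* Let $a<b$ be real numbers and let $p\ge 0$ be an integer. There is a constant $C_\infty>0$ such that for every integer $N\ge 2$, with $h=(b-a)/N$ and uniform partition $x_i=a+ih$ ($0\le i\le N$), every $u\in W^{p+1}_\infty[a,b]$, and every function $u^R$ that is a (possibly discontinuous) piecewise polynomial of degree at most $p$ on this partition, $$\|u-u^R\|_{L^\infty(a,b)}\ \ge\ h^{p+1}\left[\max_{1\le i\le N-1}\sqrt{Q(D_i^0,D_i^1,\dots,D_i^p)}\;-\;C_\infty\,|u|_{W^{p+1}_\infty[a,b]}\right],$$ where the numbers $D_i^k$ are the scaled derivative jumps of $u^R$ at $x_i$ and $Q$ is the quadratic form, both defined in the context. The constant $C_\infty$ is independent of $h$, $u$ and $u^R$.
   Context: Fix an integer $p\ge 0$ and let $\mathcal P$ be the space of real polynomials in one variable of degree at most $p$. For the uniform partition $a=x_0<x_1<\dots<x_N=b$ with $x_{i+1}-x_i=h=(b-a)/N$, let $\mathcal P_h$ be the space of functions whose restriction to each open cell $(x_i,x_{i+1})$ is a polynomial of degree at most $p$ (no continuity is required at the nodes). For $u^R\in\mathcal P_h$, $1\le i\le N-1$ and $0\le k\le p$, define the one-sided derivative values $$M_i^k=\frac{d^k}{dx^k}u^R(x_i^+),\qquad L_i^k=\frac{d^k}{dx^k}u^R(x_i^-),$$ the jumps $J_i^k=M_i^k-L_i^k$, and the scaled jumps $$D_i^k=J_i^k/h^{p+1-k}.$$ In $D^k$, $D_i^k$, etc., the superscript $k$ is an index, not a power. For real numbers $D^0,D^1,\dots,D^p$ define $$Q(D^0,D^1,\dots,D^p)=\min_{\hat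 v\in\mathcal P}\left(\left\|\hat v+\frac12\sum_{k=0}^p\frac{D^k}{k!}\xi^k\right\|^2_{L^2(-\frac12,0)}+\left\|\hat v-\frac12\sum_{k=0}^p\frac{D^k}{k!}\xi^k\right\|^2_{L^2(0,\frac12)}\right),$$ where $\xi$ is the variable of the polynomials. $W^{p+1}_\infty[a,b]$ is the standard Sobolev space of functions on the interval from $a$ to $b$ with essentially bounded (weak) derivatives up to order $p+1$, and $|u|_{W^{p+1}_\infty[a,b]}$ is its seminorm, i.e. the $L^\infty(a,b)$ norm of the derivative of $u$ of order $p+1$. *)

(* Defs.v *)
From mathcomp Require Export all_boot all_order all_algebra.
From mathcomp Require Export all_classical all_reals all_analysis.
Export Order.TTheory GRing.Theory Num.Theory numFieldNormedType.Exports.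

Set Implicit Arguments.
Unset Strict Implicit.
Unset Printing Implicit Defensive.

Local Open Scope classical_set_scope.
Local Open Scope ring_scope.

Section Defs.
Context {R : realType}.
Implicit Types (a b : R) (f u v phi : R -> R).

(* Extending f by 0 outside ]a, b[ turns the norm over the whole line into
   the norm of L^q(a, b); only the values of f on ]a, b[ matter. *)
Definition Lq_norm (q : \bar R) a b f : \bar R :=
  'N[lebesgue_measure]_q [EFin \o (f \_ `]a, b[)].

Definition in_Linfty a b f : Prop :=
  measurable_fun `]a, b[ f /\ (Lq_norm +oo a b f < +oo)%E.

Definition test_function a b phi : Prop :=
  [/\ forall (n : nat) (x : R), derivable (derive1n n phi) x 1,
      compact (closure [set x | phi x != 0]) &
      closure [set x | phi x != 0] `<=` `]a, b[ ].

Definition is_weak_derivative a b (k : nat) u v : Prop :=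
  [/\ locally_integrable `]a, b[ u, locally_integrable `]a, b[ v &
      forall phi, test_function a b phi ->
        Rintegral lebesgue_measure `]a, b[ (fun x => u x * derive1n k phi x) =
        (-1) ^+ k * Rintegral lebesgue_measure `]a, b[ (fun x => v x * phi x)].

(* Weak derivatives are unique up to a null set, so the norms of
   [weak_derivative] below do not depend on the representative chosen here. *)
Definition weak_derivative a b (k : nat) u : R -> R :=
  xget (cst 0) [set v | is_weak_derivative a b k u v].

Definition Sobolev_infty (m : nat) a b u : Prop :=
  in_Linfty a b u /\
  forall k : nat, (k <= m)%N ->
    exists v, is_weak_derivative a b k u v /\ in_Linfty a b v.

Definition Sobolev_infty_seminorm (m : nat) a b u : \bar R :=
  Lq_norm +oo a b (weak_derivative a b m u).

Definition mesh_size a b (N : nat) : R := (b - a) / N%:R.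

Definition node a b (N i : nat) : R := a + i%:R * mesh_size a b N.

(* The values at the nodes and outside [a, b] are unconstrained. *)
Definition piecewise_poly (p : nat) a b (N : nat) (w : R -> R) : Prop :=
  forall i : nat, (i < N)%N ->
    exists2 q : {poly R}, (size q <= p.+1)%N &
      forall x, x \in `]node a b N i, node a b N i.+1[ -> w x = q.[x].

Definition right_deriv (k : nat) (w : R -> R) (x : R) : R :=
  lim (derive1n k w y @[y --> x^'+]).

Definition left_deriv (k : nat) (w : R -> R) (x : R) : R :=
  lim (derive1n k w y @[y --> x^'-]).

Definition jump (k : nat) (w : R -> R) (x : R) : R :=
  right_deriv k w x - left_deriv k w x.

Definition scaled_jump (p : nat) a b (N : nat) (w : R -> R) (i : nat)
    (k : 'I_p.+1) : R :=
  jump k w (node a b N i) / mesh_size a b N ^+ (p.+1 - k).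

Definition half_taylor (p : nat) (D : 'I_p.+1 -> R) (xi : R) : R :=
  2^-1 * \sum_(k < p.+1) D k / (k`!)%:R * xi ^+ k.

(* The two L^2 norms are finite, the functions being polynomials on bounded
   intervals. *)
Definition Q_energy (p : nat) (D : 'I_p.+1 -> R) (v : {poly R}) : R :=
  fine (Lq_norm 2%:E (- 2^-1) 0 (fun xi => v.[xi] + half_taylor D xi)) ^+ 2 +
  fine (Lq_norm 2%:E 0 2^-1 (fun xi => v.[xi] - half_taylor D xi)) ^+ 2.

(* The infimum is attained (least squares on a finite-dimensional space). *)
Definition Q (p : nat) (D : 'I_p.+1 -> R) : R :=
  inf [set Q_energy D v | v in [set v : {poly R} | (size v <= p.+1)%N]].

(* For N >= 2 the range is nonempty and the terms are nonnegative, so the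
   starting value 0 is harmless. *)
Definition max_sqrt_Q (p : nat) a b (N : nat) (w : R -> R) : R :=
  \big[Num.max/0]_(1 <= i < N) Num.sqrt (Q (@scaled_jump p a b N w i)).

End Defs.

(* Main.v *)
(* Let [v] be the weak derivative of [u] of order [n = p + 1], [S] its sup norm,
   [E] the sup norm of [u - uR], and [c] an interior node.  Convolving [u] with
   a smooth bump of radius [e] and mass [m] gives a smooth function whose [n]-th
   derivative is the convolution of [v], hence is at most [S m]; so by Taylor's
   formula the mollified [u / m] is within [S h^n] of a polynomial [T] of degree
   at most [p] on [c - h/2, c + h/2].  It is also within [E + O(e)] of [uR]
   there, except within distance [e] of [c], where the error is merely bounded
   uniformly in [e].  After rescaling to a cell of length 1, the polynomials [T]
   compete in the minimum defining [Q], and letting [e] go to 0 yields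
   [h^n sqrt Q <= S h^n + E].  In particular the constant 1 is admissible. *)
Require Import Defs.
From mathcomp Require Import measurable_realfun ess_sup_inf.
From mathcomp Require Import lebesgue_integral_under ring lra.

Set Implicit Arguments.
Unset Strict Implicit.
Unset Printing Implicit Defensive.

Local Open Scope classical_set_scope.
Local Open Scope ring_scope.

(** * Calculus of finitely and infinitely differentiable functions *)

Section NDiff.
Context {R : realType}.
Local Open Scope classical_set_scope.
Implicit Types (f g : R -> R) (n : nat).

(** Smoothness of a product is proved order by order: at a fixed finite order the Leibniz rule
    allows an induction on [n], and [smooth] is recovered as [ndiff n] for all [n]. *)
Definition ndiff n f := forall k, (k < n)%N -> forall x, derivable f^`(k) x 1.

Lemma ndiffSP n f :
  ndiff n.+1 f <-> (forall x, derivable f x 1) /\ ndiff n f^`().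
Proof.
split=> [H|[H0 H] [|k] kn x]; last 2 first.
- exact: H0.
- by rewrite derive1Sn; exact: H.
split=> [x|k kn x]; first exact: (H 0%N).
by rewrite -derive1Sn; exact: H.
Qed.

Lemma ndiffW n f : ndiff n.+1 f -> ndiff n f.
Proof. by move=> H k kn; apply: H; rewrite ltnS ltnW. Qed.

Lemma ndiffD n f g : ndiff n f -> ndiff n g -> ndiff n (f \+ g).
Proof.
elim: n f g => [|n IH] f g; first by [].
move=> /ndiffSP[f0 fn] /ndiffSP[g0 gn]; apply/ndiffSP; split.
  by move=> x; exact: derivableD.
suff -> : (f \+ g)^`() = f^`() \+ g^`() by exact: IH.
by apply/funext => x; rewrite /= !derive1E deriveD.
Qed.

Lemma ndiffZ n k f : ndiff n f -> ndiff n (k \*o f).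
Proof.
elim: n f => [|n IH] f; first by [].
move=> /ndiffSP[f0 fn]; apply/ndiffSP; split.
  by move=> x; exact: derivableZ.
suff -> : (k \*o f)^`() = k \*o f^`() by exact: IH.
by apply/funext => x; rewrite /= !derive1E deriveZ.
Qed.

Lemma ndiffM n f g : ndiff n f -> ndiff n g -> ndiff n (f \* g).
Proof.
elim: n f g => [|n IH] f g; first by [].
move=> fS gS; have [f0 fn] := (ndiffSP _ _).1 fS.
have [g0 gn] := (ndiffSP _ _).1 gS; apply/ndiffSP; split.
  by move=> x; exact: derivableM.
have -> : (f \* g)^`() = (f \* g^`()) \+ (g \* f^`()).
  by apply/funext => x; rewrite /= !derive1E deriveM.
by apply: ndiffD; apply: IH => //; exact: ndiffW.
Qed.

Definition smooth f := forall n x, derivable f^`(n) x 1.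

Lemma smoothP f : smooth f <-> forall n, ndiff n f.
Proof. by split=> [H n k _ x|H n x]; [exact: H|exact: (H n.+1)]. Qed.

Lemma smoothM f g : smooth f -> smooth g -> smooth (f \* g).
Proof. by move=> /smoothP f_ /smoothP g_; apply/smoothP => n; exact: ndiffM. Qed.

Lemma derive1n_affine f (s c : R) n : smooth f ->
  (fun y => f (s * y + c))^`(n) = (fun y => s ^+ n * derive1n n f (s * y + c)).
Proof.
move=> sf; elim: n => [|n IH]; first by apply/funext => y; rewrite expr0 mul1r.
rewrite derive1nS IH; apply/funext => y.
rewrite derive1E.
have dg : is_derive y 1 (fun y : R => s * y + c) s.
  by apply: is_derive_eq; rewrite /GRing.scale/= mulr1 addr0.
have df : is_derive (s * y + c) 1 (derive1n n f) (derive1n n.+1 f (s * y + c)).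
  by rewrite derive1nS derive1E; apply: DeriveDef => //; exact: sf.
have dfg := @is_derive1_comp _ (derive1n n f) (fun y : R => s * y + c) y _ _ df dg.
rewrite -[fun y => _]/(s ^+ n \*o (derive1n n f \o (fun y : R => s * y + c))).
rewrite deriveZ; last by case: dfg.
by rewrite derive_val /GRing.scale /= exprSr [_ * s]mulrC mulrA.
Qed.

Lemma smooth_affine f (s c : R) : smooth f -> smooth (fun y => f (s * y + c)).
Proof.
move=> sf n y; rewrite derive1n_affine//.
rewrite -[fun y => _]/(s ^+ n \*o (derive1n n f \o (fun y : R => s * y + c))).
apply: derivableZ; apply/derivable1_diffP; apply: differentiable_comp => //.
exact/derivable1_diffP/sf.
Qed.

Lemma smooth_continuous f n : smooth f -> continuous f^`(n).
Proof.
by move=> sf x; apply/differentiable_continuous/derivable1_diffP; exact: sf.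
Qed.

End NDiff.

(** * A smooth bump supported in a small interval *)

Section Bump.
Context {R : realType}.
Local Open Scope classical_set_scope.

(* The derivatives of [flat k] are linear combinations of the [flat j]. *)
Definition flat (k : nat) (x : R) : R :=
  if 0 < x then x^-1 ^+ k * expR (- x^-1) else 0.

Lemma flat_ge0 k x : 0 <= flat k x.
Proof.
rewrite /flat; case: ltP => // x0.
by rewrite mulr_ge0 ?expR_ge0// exprn_ge0// invr_ge0 ltW.
Qed.

Lemma flat_gt0 k x : 0 < x -> 0 < flat k x.
Proof. by move=> x0; rewrite /flat x0 mulr_gt0 ?expR_gt0// exprn_gt0// invr_gt0. Qed.

Lemma flat_le0 k x : x <= 0 -> flat k x = 0.
Proof. by move=> x0; rewrite /flat ltNge x0. Qed.

(** With [t = 1 / x], the exponential series gives [t ^ (k + 2) / (k + 2)! <= exp t]. A quadratic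
    bound is what makes the difference quotient of [flat k] at 0 tend to 0. *)
Lemma flat_le_sqr k x : flat k x <= (k.+2)`!%:R * x ^+ 2.
Proof.
rewrite /flat; case: ltP => x0; last by rewrite mulr_ge0 ?sqr_ge0.
have t0 : 0 < x^-1 by rewrite invr_gt0.
have := expR_ge1Dxn k.+1 (ltW t0).
rewrite expRN; set e := expR _ => He.
have e0 : 0 < e by exact: expR_gt0.
have F0 : (0 : R) < (k.+2)`!%:R by rewrite ltr0n fact_gt0.
rewrite ler_pdivrMr//.
have : x^-1 ^+ k.+2 / (k.+2)`!%:R <= e by apply: le_trans He; rewrite lerDr.
rewrite ler_pdivrMr// => H.
have -> : x^-1 ^+ k = x ^+ 2 * x^-1 ^+ k.+2.
  by rewrite -(addn2 k) exprD mulrCA -exprMn mulfV ?gt_eqF// expr1n mulr1.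
have -> : (k.+2)`!%:R * x ^+ 2 * e = x ^+ 2 * (e * (k.+2)`!%:R) by ring.
by rewrite ler_wpM2l ?sqr_ge0.
Qed.

Lemma is_derive_flat k (x : R) :
  is_derive x 1 (flat k) (flat k.+2 x - k%:R * flat k.+1 x).
Proof.
have [x0|x0|->] := ltgtP x 0.
- rewrite !flat_le0 ?ltW// mulr0 subr0.
  apply: (@near_eq_is_derive _ _ _ (cst 0)).
    near=> y; rewrite [RHS]flat_le0//; apply: ltW; near: y.
    exact: lt_nbhsl.
- have nx : x != 0 by rewrite gt_eqF.
  apply: (@near_eq_is_derive _ _ _
    ((fun y : R => y^-1) ^+ k * (expR \o (fun y : R => - y^-1)))).
    near=> y; rewrite /flat; have -> : 0 < y by near: y; exact: lt_nbhsr.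
    by rewrite exprfctE.
  have dV : is_derive x 1 (fun y : R => y^-1) (- x ^- 2).
    apply: DeriveDef; first exact: (@derivableV _ _ id).
    by rewrite (@deriveV _ _ id)// derive_id /GRing.scale/= mulr1.
  have dE : is_derive x 1 (expR \o (fun y : R => - y^-1)) (expR (- x^-1) * x ^- 2).
    apply: is_derive1_comp; apply: is_derive_eq; by rewrite opprK.
  apply: is_derive_eq.
  rewrite /flat x0 /GRing.scale/= exprfctE.
  case: k => [|k] /=.
    rewrite -!exprVn; ring.
  rewrite -exprVn !exprS; ring.
- rewrite !flat_le0// mulr0 subr0.
  have H : (fun h : R => h^-1 *: ((flat k \o shift 0) (h *: 1) - flat k 0))
      @ 0^' --> (0 : R).
    apply/cvgrPdist_le => e e0.
    have F0 : (0 : R) < (k.+2)`!%:R by rewrite ltr0n fact_gt0.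
    near=> h.
    have h0 : h != 0 by near: h; exact: nbhs_dnbhs_neq.
    rewrite /= sub0r normrN addr0 (@flat_le0 _ 0)// subr0 /GRing.scale/= mulr1.
    rewrite normrM normfV ler_pdivrMl ?normr_gt0// ger0_norm ?flat_ge0//.
    rewrite (le_trans (flat_le_sqr _ _))// -real_normK ?num_real// expr2 mulrCA.
    rewrite ler_wpM2l// -ler_pdivlMl//.
    near: h; apply: dnbhs0_le; rewrite mulr_gt0// invr_gt0//.
  apply: DeriveDef; last exact: cvg_lim H.
  by apply/cvg_ex; exists 0.
Unshelve. all: end_near. Qed.

Lemma smooth_flat k : smooth (flat k).
Proof.
apply/smoothP => n; elim: n k => [|n IH] k; first by [].
apply/ndiffSP; split; first by move=> x; case: (is_derive_flat k x).
have -> : (flat k)^`() = flat k.+2 \+ (- k%:R \*o flat k.+1).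
  apply/funext => x; rewrite derive1E; have [_ ->] := is_derive_flat k x.
  by rewrite /= mulNr.
by apply: ndiffD => //; exact: ndiffZ.
Qed.

(** The bump is not normalized; its mass is divided out once the mollified function has been
    approximated by a polynomial. *)
Lemma exists_bump (e : R) : 0 < e -> exists rho : R -> R,
  [/\ smooth rho, forall x, 0 <= rho x, 0 < rho 0 &
      forall x, e <= `|x| -> rho x = 0].
Proof.
(* The product of [exp (- 1 / (e + x))] and [exp (- 1 / (e - x))], each cut off at 0, is positive
   exactly when [|x| < e]. *)
move=> e0; exists ((fun x => flat 0 (1 * x + e)) \* (fun x => flat 0 (-1 * x + e))).
split=> /=.
- by apply: smoothM; apply: smooth_affine; exact: smooth_flat.
- by move=> x; rewrite mulr_ge0 ?flat_ge0.
- by rewrite !mulr0 !add0r mulr_gt0 ?flat_gt0.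
- move=> x; rewrite ler_normr mul1r mulN1r => /orP[ex|ex].
    by rewrite (@flat_le0 _ (- x + e)) ?mulr0// addrC subr_le0.
  by rewrite (@flat_le0 _ (x + e)) ?mul0r// -lerBrDr sub0r lerNr.
Qed.


End Bump.

(** * Domination of integrals almost everywhere *)

Section AeBound.
Context d {T : measurableType d} {R : realType}.
Variable mu : {measure set T -> \bar R}.
Local Open Scope classical_set_scope.
Implicit Types (D : set T) (f g : T -> R).

Lemma ae_le_integrable D f g : measurable D -> measurable_fun D f ->
  mu.-integrable D (EFin \o g) ->
  {ae mu, forall x, D x -> `|f x| <= g x} -> mu.-integrable D (EFin \o f).
Proof.
move=> mD mf ig fg; have /integrableP[/measurable_EFinP mg goo] := ig.
apply/integrableP; split; first exact/measurable_EFinP.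
apply: le_lt_trans goo; apply: ae_ge0_le_integral => //=.
- exact/measurable_EFinP/measurableT_comp.
- exact/measurable_EFinP/measurableT_comp.
- apply: filterS fg => x fg Dx; rewrite lee_fin (le_trans (fg Dx))//.
  exact: ler_norm.
Qed.

Lemma ae_normr_Rintegral_le D f g : measurable D -> measurable_fun D f ->
  mu.-integrable D (EFin \o g) ->
  {ae mu, forall x, D x -> `|f x| <= g x} ->
  `|\int[mu]_(x in D) f x| <= \int[mu]_(x in D) g x.
Proof.
move=> mD mf ig fg; have intf := ae_le_integrable mD mf ig fg.
have /integrableP[/measurable_EFinP mg goo] := ig.
have /integrableP[_ foo] := intf.
rewrite (le_trans (le_normr_Rintegral _ _))//.
have g0 : {ae mu, forall x, D x -> `|f x| <= `|g x|}.
  by apply: filterS fg => x fg Dx; rewrite (le_trans (fg Dx)) ?ler_norm.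
(* The bound [g] is nonnegative only almost everywhere, so it is exchanged for [|g|] before the
   integrals are compared. *)
have -> : \int[mu]_(x in D) g x = \int[mu]_(x in D) `|g x|.
  congr fine; apply: ae_eq_integral => //.
  - exact/measurable_EFinP.
  - exact/measurable_EFinP/measurableT_comp.
  - apply: filterS fg => x fg Dx; rewrite ger0_norm//.
    exact: le_trans (fg Dx).
apply: fine_le.
- by rewrite ge0_fin_numE// integral_ge0.
- by rewrite ge0_fin_numE// integral_ge0.
- apply: ae_ge0_le_integral => //=.
  + exact/measurable_EFinP/measurableT_comp.
  + exact/measurable_EFinP/measurableT_comp.
Qed.

End AeBound.

(** * Convolution with a smooth kernel and its derivatives *)

Section Mollification.
Context {R : realType}.
Local Open Scope classical_set_scope.
Notation mu := (@lebesgue_measure R).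
Implicit Types (D : set R) (f g rho : R -> R).

(** The strict inequality [e < |x|] is an open condition, so the derivative at [x] sees only zero
    values and the induction on [k] goes through. *)
Lemma derive1n_supp rho (e : R) k x : (forall x, e <= `|x| -> rho x = 0) ->
  e < `|x| -> rho^`(k) x = 0.
Proof.
move=> rho0; elim: k x => [|k IH] x ex; first by rewrite derive1n0 rho0 ?ltW.
rewrite derive1nS derive1E -(@derive_cst _ R R (0:R) x 1); apply: near_eq_derive.
have : \forall y \near x, e < `|y|.
  exact: (cvgr_gt `|x| (@norm_continuous _ R x)).
by apply: filterS => y ey; rewrite IH.
Qed.

Lemma derive1n_bounded rho (e : R) k : smooth rho -> 0 < e ->
  (forall x, e <= `|x| -> rho x = 0) ->
  exists M, forall x, `|derive1n k rho x| <= M.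
Proof.
move=> srho e0 rho0.
have [||c _ H] := @EVT_max _ (fun x => `|derive1n k rho x|) (- e) e.
- by rewrite ge0_cp// ltW.
- apply: continuous_subspaceT => x; apply: continuous_comp.
    exact: smooth_continuous.
  exact: norm_continuous.
exists `|derive1n k rho c| => x; have [xe|ex] := leP `|x| e.
  by apply: H; rewrite in_itv/= -ler_norml.
by rewrite (derive1n_supp k rho0 ex) normr0.
Qed.

Lemma measurable_comp_reflect f x D : measurable D -> continuous f ->
  measurable_fun D (fun y => f (x - y)).
Proof.
move=> mD cf; apply: measurable_funTS; apply: continuous_measurable_fun => y.
apply: (@continuous_comp _ _ _ (fun y => x - y) f); last exact: cf.
by apply: cvgB; [exact: cvg_cst|exact: cvg_id].
Qed.

Lemma integrable_mul_reflect D g f M x : measurable D ->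
  mu.-integrable D (EFin \o g) -> continuous f -> (forall y, `|f y| <= M) ->
  mu.-integrable D (EFin \o (fun y => g y * f (x - y))).
Proof.
move=> mD ig cf fM.
apply: (@integrableMl _ _ _ mu D mD (EFin \o g) (fun y => f (x - y))) => //.
- exact: measurable_comp_reflect.
- exists M; split; first exact: num_real.
  by move=> t Mt y _ /=; rewrite (le_trans (fM _))// ltW.
Qed.

(** This is the convolution over the line of [f] with the extension of [g] by 0 outside [D]. *)
Definition convolve D g f (x : R) := \int[mu]_(y in D) (g y * f (x - y)).

(** Differentiation under the integral sign: the partial derivative in [x] is dominated, uniformly
    in [x], by the integrable function [|g| M2]. *)
Lemma is_derive_convolve D g f (M1 M2 x : R) : measurable D ->
  mu.-integrable D (EFin \o g) -> smooth f ->
  (forall y, `|f y| <= M1) -> (forall y, `|derive1 f y| <= M2) ->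
  is_derive x 1 (convolve D g f) (convolve D g (derive1 f) x).
Proof.
move=> mD ig sf f1 f2.
have cf : continuous f by exact: (@smooth_continuous _ _ 0).
have dF (y z : R) : is_derive z 1 (fun z => g y * f (z - y)) (g y * derive1 f (z - y)).
  have df : is_derive (z - y) 1 f (derive1 f (z - y)).
    by rewrite derive1E; apply: DeriveDef => //; exact: (sf 0%N).
  have ds : is_derive z 1 (fun z : R => z - y) 1.
    by apply: is_derive_eq; rewrite subr0.
  have dfs := @is_derive1_comp _ f (fun z : R => z - y) z _ _ df ds.
  have := is_deriveZ (f := f \o (fun z : R => z - y)) (g y) dfs.
  by rewrite mulr1.
have d1 z y : partial1of2 (fun z y => g y * f (z - y)) z y = g y * derive1 f (z - y).
  by rewrite /partial1of2 derive1E; have [_ ->] := dF y z.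
pose G y := `|g y| * M2.
have M20 : 0 <= M2 by apply: le_trans (f2 0); exact: normr_ge0.
have G0 y : 0 <= G y by rewrite mulr_ge0.
have xI : `]x - 1, x + 1[ x by rewrite /= in_itv/= ltrBlDr !ltrDl ltr01.
have iF z : `]x - 1, x + 1[ z -> mu.-integrable D (EFin \o (fun y => g y * f (z - y))).
  by move=> _; exact: integrable_mul_reflect ig cf f1.
have dF1 z y : `]x - 1, x + 1[ z -> D y -> derivable (fun z => g y * f (z - y)) z 1.
  by move=> _ _; have [] := dF y z.
have iG : mu.-integrable D (EFin \o G).
  have -> : EFin \o G = (fun y => M2%:E * (EFin \o (fun y => `|g y|%R)) y)%E.
    by apply/funext => y; rewrite /G/= mulrC EFinM.
  by apply: integrableZl => //; exact: integrable_norm.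
have Gub z y : `]x - 1, x + 1[ z -> D y ->
    `|partial1of2 (fun z y => g y * f (z - y)) z y| <= G y.
  by move=> _ _; rewrite d1 normrM ler_wpM2l.
have H1 := @derivable_under_integral _ _ _ mu (fun z y => g y * f (z - y)) D mD
  _ _ _ xI iF dF1 G G0 iG Gub.
have H2 := @differentiation_under_integral _ _ _ mu (fun z y => g y * f (z - y)) D mD
  _ _ _ xI iF dF1 G G0 iG Gub.
apply: DeriveDef => //; rewrite -derive1E H2.
by apply: eq_Rintegral => y _; rewrite d1.
Qed.

Lemma derive1n_convolve D g rho e k : measurable D ->
  mu.-integrable D (EFin \o g) -> smooth rho -> 0 < e ->
  (forall x, e <= `|x| -> rho x = 0) ->
  (convolve D g rho)^`(k) = convolve D g (derive1n k rho).
Proof.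
move=> mD ig srho e0 rho0; elim: k => [//|k IH].
rewrite derive1nS IH; apply/funext => x.
have [M1 HM1] := derive1n_bounded k srho e0 rho0.
have [M2 HM2] := derive1n_bounded k.+1 srho e0 rho0.
have sk : smooth (derive1n k rho).
  by move=> n y; rewrite /derive1n -iterD; exact: (srho (n + k)%N).
have := @is_derive_convolve D g (derive1n k rho) M1 M2 x mD ig sk HM1.
by rewrite -derive1nS => /(_ HM2)[_ <-]; rewrite derive1E.
Qed.

Lemma smooth_convolve D g rho e : measurable D ->
  mu.-integrable D (EFin \o g) -> smooth rho -> 0 < e ->
  (forall x, e <= `|x| -> rho x = 0) -> smooth (convolve D g rho).
Proof.
move=> mD ig srho e0 rho0 k x; rewrite (derive1n_convolve k mD ig srho e0 rho0).
have [M1 HM1] := derive1n_bounded k srho e0 rho0.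
have [M2 HM2] := derive1n_bounded k.+1 srho e0 rho0.
have sk : smooth (derive1n k rho).
  by move=> n y; rewrite /derive1n -iterD; exact: (srho (n + k)%N).
have := @is_derive_convolve D g (derive1n k rho) M1 M2 x mD ig sk HM1.
by rewrite -derive1nS => /(_ HM2)[].
Qed.

End Mollification.

(** * Taylor approximation by polynomials *)

Section Taylor.
Context {R : realType}.
Local Open Scope classical_set_scope.
Implicit Types (f : R -> R) (q : {poly R}).

Lemma exists_antideriv q n : (size q <= n)%N ->
  exists2 Q : {poly R}, (size Q <= n.+1)%N & deriv Q = q.
Proof.
move=> qn; exists (\poly_(i < n.+1) (q`_i.-1 / i%:R)); first exact: size_poly.
apply/polyP => i; rewrite coef_deriv coef_poly ltnS; case: ltnP => ni /=.
  by rewrite -(mulr_natr (q`_i / i.+1%:R)) divfK ?pnatr_eq0.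
by rewrite mul0rn nth_default// (leq_trans qn).
Qed.

Lemma is_derive_mean_value f df (c x : R) :
  (forall y : R, is_derive y 1 f (df y)) ->
  exists2 y, `|y - c| <= `|x - c| & f x - f c = df y * (x - c).
Proof.
move=> fdf; have cf : continuous f.
  by move=> y; apply/differentiable_continuous/derivable1_diffP; case: (fdf y).
have [cx|/ltW xc] := leP c x.
  have [y] := @MVT_segment _ f df _ _ cx (fun y _ => fdf y)
    (continuous_subspaceT cf).
  rewrite in_itv/= => /andP[cy yx] ->; exists y => //.
  by rewrite !ger0_norm ?subr_ge0// lerD2r.
have [y] := @MVT_segment _ f df _ _ xc (fun y _ => fdf y)
  (continuous_subspaceT cf).
rewrite in_itv/= => /andP[cy yx] H; exists y; last first.
  by rewrite -opprB H -mulrN opprB.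
by rewrite !ler0_norm ?subr_le0// lerN2 lerD2r.
Qed.

(** Induction on [n]: take an antiderivative of the polynomial found for [f'], shift it to agree
    with [f] at [c], and apply the mean value theorem to the difference. Using the mean value
    theorem instead of integrating gives the constant 1 in place of [1 / n!]. *)
Lemma taylor_poly_bound f n (c r S : R) : smooth f ->
  (forall x, `|x - c| <= r -> `|derive1n n f x| <= S) ->
  exists2 T : {poly R}, (size T <= n)%N &
    forall x, `|x - c| <= r -> `|f x - T.[x]| <= S * `|x - c| ^+ n.
Proof.
elim: n f => [|n IH] f sf fS.
  by exists 0 => [|x /fS]; rewrite ?size_poly0// horner0 subr0 expr0 mulr1.
have sf' : smooth (derive1 f).
  by move=> k x; rewrite -derive1Sn; exact: sf.
have [|T1 sT1 H1] := IH _ sf'.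
  by move=> x xr; rewrite -derive1Sn; exact: fS.
have [Q sQ dQ] := exists_antideriv sT1.
exists (Q + (f c - Q.[c])%:P).
  by rewrite (leq_trans (size_polyD _ _))// geq_max sQ (leq_trans (size_polyC_leq1 _)).
move=> x xr; rewrite hornerD hornerC.
have dg (y : R) : is_derive y 1 (f \- horner Q) (derive1 f y - T1.[y]).
  apply: is_deriveB; first by rewrite derive1E; apply: DeriveDef => //; exact: (sf 0%N).
  by rewrite -dQ; exact: is_derive_poly.
have [y yx /= H] := is_derive_mean_value c x dg.
have -> : f x - (Q.[x] + (f c - Q.[c])) = f x - Q.[x] - (f c - Q.[c]) by ring.
rewrite H normrM exprSr mulrA ler_wpM2r//.
rewrite (le_trans (H1 _ (le_trans yx xr)))// ler_wpM2l ?lerXn2r ?nnegrE//.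
exact: le_trans (fS _ xr).
Qed.

End Taylor.

(** * Mollification by a bump on a bounded interval *)

Section Mollifier.
Context {R : realType}.
Local Open Scope classical_set_scope.
Notation mu := (@lebesgue_measure R).
Variables (a b e : R) (rho : R -> R).
Hypotheses (srho : smooth rho) (rho_ge0 : forall x, 0 <= rho x).
Hypotheses (rho0_gt0 : 0 < rho 0) (e0 : 0 < e).
Hypothesis rho_supp : forall x, e <= `|x| -> rho x = 0.
Let D := `]a, b[%classic.
Let mD : measurable D. Proof. exact: measurable_itv. Qed.

Let integrable_cst r : mu.-integrable D (EFin \o cst r).
Proof.
apply: measurable_bounded_integrable => //; last exact: bounded_cst.
by rewrite /= lebesgue_measure_itv/=; case: ifP => // _; rewrite -EFinB ltry.
Qed.

Let integrable_reflect x : mu.-integrable D (EFin \o (fun y => rho (x - y))).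
Proof.
have [M HM] := derive1n_bounded 0%N srho e0 rho_supp.
have := @integrable_mul_reflect _ D (cst 1) rho M x mD (integrable_cst 1)
  (@smooth_continuous _ rho 0 srho) HM.
by congr (_.-integrable _ _); apply/funext => y /=; rewrite mul1r.
Qed.

Lemma convolve_mass x : convolve D (cst 1) rho x = \int[mu]_(y in D) rho (x - y).
Proof. by apply: eq_Rintegral => y _; rewrite mul1r. Qed.

(** By continuity [rho > rho 0 / 2] within some distance [d] of 0, so the integrand exceeds
    [rho 0 / 2] on an interval of positive length to the right of [x] inside []a, b[]. *)
Lemma convolve_mass_gt0 x : a < x -> x < b -> 0 < convolve D (cst 1) rho x.
Proof.
move=> ax xb; rewrite convolve_mass.
have : \forall y \near (0 : R), rho 0 / 2 < rho y.
  apply: (cvgr_gt (rho 0) (@smooth_continuous _ rho 0 srho (0 : R))).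
  by rewrite ltr_pdivrMr// ltr_pMr// ltr1n.
case=> d /= d0 Hd.
pose I := `]x, (Num.min b (x + d))[%classic.
have ID : I `<=` D.
  move=> y; rewrite /I/D/= !in_itv/= lt_min => /andP[xy /andP[yb _]].
  by rewrite (lt_trans ax xy).
have mI : measurable I by exact: measurable_itv.
have xm : x < Num.min b (x + d) by rewrite lt_min xb ltrDl.
apply: (@lt_le_trans _ _ (\int[mu]_(y in D) (rho 0 / 2 * \1_I y))).
  rewrite RintegralZl//; last first.
    apply: (integrableS measurableT) => //; exact: integrable_indic_itv.
  rewrite mulr_gt0 ?divr_gt0// /Rintegral integral_indic//.
  have -> : I `&` D = I by apply/setIidl.
  rewrite -[X in fine X]/(lebesgue_measure I) /I lebesgue_measure_itv/= lte_fin xm/=.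
  by rewrite subr_gt0.
apply: le_Rintegral => //.
  apply: (@integrableZl _ _ _ mu _ mD (rho 0 / 2) (EFin \o \1_I)).
  by apply: (integrableS measurableT) => //; exact: integrable_indic_itv.
move=> y Dy; rewrite indicE; case: (boolP (y \in I)) => [|_]; last by rewrite mulr0.
rewrite inE /I/= in_itv/= lt_min => /and3P[xy yb yd]; rewrite mulr1.
apply/ltW/Hd; rewrite /= sub0r normrN ltr0_norm ?subr_lt0//; lra.
Qed.

(** The derivative of the mass at [z] is the integral of [rho' (z - t)] over [t], which equals
    [rho (z - a) - rho (z - b)]. Both terms vanish when [z] is farther than [e] from the
    endpoints. *)
Lemma convolve_mass_cst (x y : R) : a + e < x < b - e -> a + e < y < b - e ->
  convolve D (cst 1) rho x = convolve D (cst 1) rho y.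
Proof.
wlog xy : x y / x <= y.
  move=> H Hx Hy; have [xy|/ltW yx] := leP x y; first exact: H.
  by apply/esym; exact: H.
move=> /andP[ax xb] /andP[ay yb].
have e_gt0 := e0; have ab : a < b by lra.
pose F := convolve D (cst 1) rho.
have sF : smooth F by exact: (smooth_convolve mD (integrable_cst 1) srho e0 rho_supp).
have dF (z : R) : x <= z <= y -> derive1 F z = 0.
  move=> /andP[xz zy].
  have := derive1n_convolve 1 mD (integrable_cst 1) srho e0 rho_supp.
  rewrite derive1n1 /F => ->; rewrite /convolve derive1n1.
  pose G t := - rho (z - t).
  have dG (t : R) : is_derive t 1 G (derive1 rho (z - t)).
    have d1 : is_derive (z - t) 1 rho (derive1 rho (z - t)).
      by rewrite derive1E; apply: DeriveDef => //; exact: (@srho 0%N).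
    have d2 : is_derive t 1 (fun t : R => z - t) (- 1).
      by apply: is_derive_eq; rewrite add0r mul1r.
    have := is_deriveN (@is_derive1_comp _ rho (fun t : R => z - t) t _ _ d1 d2).
    by rewrite mulrN1 opprK.
  have cG : continuous G.
    by move=> t; apply/differentiable_continuous/derivable1_diffP; case: (dG t).
  have cr : {within `[a, b], continuous (fun t => derive1 rho (z - t))}.
    apply: continuous_subspaceT => t.
    apply: (@continuous_comp _ _ _ (fun t : R => z - t) (derive1 rho)).
      by apply: cvgB; [exact: cvg_cst|exact: cvg_id].
    exact: (@smooth_continuous _ rho 1 srho).
  have := @continuous_FTC2 _ _ G _ _ ab cr.
  have -> : G b = 0.
    rewrite /G rho_supp ?oppr0// ler_normr; apply/orP; right; lra.
  have -> : G a = 0.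
    rewrite /G rho_supp ?oppr0// ler_normr; apply/orP; left; lra.
  rewrite sube0 => FTC; rewrite /Rintegral.
  under eq_integral do rewrite mul1r.
  rewrite -(integral_itv_bndoo true false); last first.
    apply/measurable_EFinP; apply: measurable_comp_reflect => //.
    exact: (@smooth_continuous _ rho 1 srho).
  rewrite FTC//; first last.
    by move=> t _; rewrite derive1E; case: (dG t).
  by split; [move=> t _; case: (dG t)|apply: cvg_at_right_filter; exact: cG
    |apply: cvg_at_left_filter; exact: cG].
have dF' (z : R) : is_derive z 1 F (derive1 F z).
  by rewrite derive1E; apply: DeriveDef => //; exact: (sF 0%N).
have [z zxy] := @MVT_segment _ F (derive1 F) _ _ xy (fun z _ => dF' z)
  (continuous_subspaceT (@smooth_continuous _ _ 0 sF)).
rewrite dF; last by move: zxy; rewrite in_itv.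
by rewrite mul0r => /subr0_eq.
Qed.

(** The difference is the integral of [(g y - t) * rho (x - y)], to which only [|y - x| < e]
    contributes. It serves twice: with [t = 0] to bound the mollified derivative, and with [t] a
    value of the piecewise polynomial. *)
Lemma convolve_near (g : R -> R) (t K x : R) : mu.-integrable D (EFin \o g) ->
  {ae mu, forall y, D y -> `|y - x| < e -> `|g y - t| <= K} ->
  `|convolve D g rho x - t * convolve D (cst 1) rho x|
    <= K * convolve D (cst 1) rho x.
Proof.
move=> ig gt.
have [M HM] := derive1n_bounded 0%N srho e0 rho_supp.
have igr : mu.-integrable D (EFin \o (fun y => g y * rho (x - y))).
  exact: (integrable_mul_reflect _ mD ig (@smooth_continuous _ rho 0 srho) HM).
have itr : mu.-integrable D (EFin \o (fun y => t * rho (x - y))).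
  exact: (@integrableZl _ _ _ mu _ mD t _ (integrable_reflect x)).
have iKr : mu.-integrable D (EFin \o (fun y => K * rho (x - y))).
  exact: (@integrableZl _ _ _ mu _ mD K _ (integrable_reflect x)).
rewrite !convolve_mass -!RintegralZl// -RintegralB//.
apply: ae_normr_Rintegral_le => //.
  by apply: measurable_funB; apply/measurable_EFinP;
    [exact: measurable_int igr|exact: measurable_int itr].
apply: (@filterS _ _ (ae_filter_ringOfSetsType mu) _ _ _ gt) => y gy Dy.
rewrite -mulrBl normrM (ger0_norm (rho_ge0 _)).
have [yx|xy] := ltP `|y - x| e; first by rewrite ler_wpM2r// gy.
by rewrite rho_supp ?mulr0// distrC.
Qed.

(** The function [y |-> rho (x - y)] is a test function because its support lies in
    [[x - e, x + e]], inside []a, b[]. The sign [(-1) ^ n] from its [n]-th derivative cancels the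
    one in the definition of the weak derivative. *)
Lemma derive1n_convolve_weak (u v : R -> R) n (x : R) : a + e < x < b - e ->
  mu.-integrable D (EFin \o u) -> is_weak_derivative a b n u v ->
  derive1n n (convolve D u rho) x = convolve D v rho x.
Proof.
move=> /andP[ax xb] iu [_ _ weak].
have e_gt0 := e0.
rewrite (derive1n_convolve n mD iu srho e0 rho_supp).
pose phi (y : R) := rho (-1 * y + x).
have phiE y : phi y = rho (x - y) by rewrite /phi mulN1r addrC.
have tphi : test_function a b phi.
  have supp : closure [set y | phi y != 0] `<=` `[x - e, x + e].
    rewrite [X in _ `<=` X](closure_id _).1; last exact: interval_closed.
    apply: closureS => y /= yN0; rewrite in_itv/= -ler_distl distrC.
    rewrite leNgt; apply: contra yN0 => /ltW xy.
    by rewrite phiE rho_supp.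
  split.
  - exact: smooth_affine.
  - apply: (@subclosed_compact _ _ `[x - e, x + e]) => //.
      exact: closed_closure.
    exact: segment_compact.
  - move=> y /supp; rewrite /= !in_itv/= => /andP[xy yx]; apply/andP; split; lra.
have := weak _ tphi; rewrite /convolve.
have -> : phi^`(n) = (fun y => (-1) ^+ n * derive1n n rho (x - y)).
  by rewrite derive1n_affine//; apply/funext => y; rewrite mulN1r addrC.
move=> H; apply: (@mulfI _ ((-1) ^+ n)); first by rewrite signr_eq0.
have [M HM] := derive1n_bounded n srho e0 rho_supp.
have ir : mu.-integrable D (EFin \o (fun y => u y * derive1n n rho (x - y))).
  exact: (integrable_mul_reflect _ mD iu (@smooth_continuous _ rho n srho) HM).
rewrite -RintegralZl//.
under eq_Rintegral do rewrite mulrCA.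
rewrite H; congr (_ * _).
by apply: eq_Rintegral => y _; rewrite phiE.
Qed.

End Mollifier.

(** * Polynomial approximation around one node *)

Section LocalApproximation.
Context {R : realType}.
Local Open Scope classical_set_scope.
Notation mu := (@lebesgue_measure R).
Implicit Types (q ql qr : {poly R}).

Lemma poly_bounded q (c r : R) : 0 <= r ->
  exists2 B, 0 <= B & forall x, `|x - c| <= r -> `|q.[x]| <= B.
Proof.
move=> r0; have [||x0 _ H] := @EVT_max _ (fun x => `|q.[x]|) (c - r) (c + r).
- by rewrite lerD2l ge0_cp.
- apply: continuous_subspaceT => x; apply: continuous_comp.
    exact: continuous_horner.
  exact: norm_continuous.
exists `|q.[x0]| => // x xr; apply: H.
by rewrite in_itv/= -ler_distl.
Qed.

Lemma poly_lipschitz q (c r : R) : 0 <= r ->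
  exists2 L, 0 <= L & forall x y, `|x - c| <= r -> `|y - c| <= r ->
    `|q.[x] - q.[y]| <= L * `|x - y|.
Proof.
(* The mean value point is only known to satisfy [|z - y| <= |x - y| <= 2 r], so it may lie as far
   as [3 r] from [c]. *)
move=> r0; have r30 : 0 <= 3 * r by rewrite mulr_ge0.
have [L L0 HL] := poly_bounded (deriv q) c r30.
exists L => // x y xr yr.
have [z zx ->] := @is_derive_mean_value _ (horner q) (horner (deriv q)) y x
  (fun z => is_derive_poly q z).
rewrite normrM ler_wpM2r// HL//.
have : `|z - c| <= `|z - y| + `|y - c|.
  by rewrite (le_trans _ (ler_normD _ _))// addrA subrK.
have : `|x - y| <= `|x - c| + `|y - c|.
  by rewrite [`|y - c|]distrC (le_trans _ (ler_normD _ _))// addrA subrK.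
lra.
Qed.

(** With [ql] and [qr] the pieces of the spline on the cells meeting at the node [c], this agrees
    with the spline on both open cells. *)
Definition two_sided ql qr (c x : R) := if x < c then ql.[x] else qr.[x].

(** If [e <= |x - c|], a point [y] within [e] of [x] is on the same side of [c], and the Lipschitz
    bound of one polynomial applies; otherwise only boundedness is available. Neither constant
    depends on [e]. *)
Lemma two_sided_oscillation ql qr (c r : R) : 0 <= r ->
  exists L B : R, [/\ 0 <= L, 0 <= B & forall (e x y : R),
    `|x - c| <= r -> `|y - c| <= r -> `|y - x| < e ->
    `|two_sided ql qr c y - two_sided ql qr c x|
      <= if e <= `|x - c| then L * e else B].
Proof.
move=> r0; have [Bl Bl0 HBl] := poly_bounded ql c r0.
have [Br Br0 HBr] := poly_bounded qr c r0.
have [Ll Ll0 HLl] := poly_lipschitz ql c r0.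
have [Lr Lr0 HLr] := poly_lipschitz qr c r0.
have HB x : `|x - c| <= r -> `|two_sided ql qr c x| <= Bl + Br.
  move=> xr; rewrite /two_sided; case: ifP => _.
    by rewrite (le_trans (HBl _ xr))// lerDl.
  by rewrite (le_trans (HBr _ xr))// lerDr.
exists (Ll + Lr), ((Bl + Br) + (Bl + Br)); split; rewrite ?addr_ge0//.
move=> e x y xr yr yxe; case: ifPn => [ex|_]; last first.
  by rewrite (le_trans (ler_normB _ _))// lerD// HB.
move: (yxe); rewrite ltr_distl => /andP[yx1 yx2].
have Le L : 0 <= L -> L <= Ll + Lr -> L * `|y - x| <= (Ll + Lr) * e.
  by move=> L0 LL; rewrite ler_pM// ltW.
rewrite /two_sided; have [xc|cx] := ltP x c.
  have yc : y < c by move: ex; rewrite ltr0_norm ?subr_lt0//; lra.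
  by rewrite yc (le_trans (HLl _ _ yr xr))// Le// lerDl.
have yc : c <= y by move: ex; rewrite ger0_norm ?subr_ge0//; lra.
by rewrite ltNge yc/= (le_trans (HLr _ _ yr xr))// Le// lerDr.
Qed.

(** The constants [L] and [B] are fixed before [e], while [T] may vary with [e], so that [e] can
    later go to 0. The condition [e < h / 2] keeps the [e]-neighbourhood of every [x] in the
    half-cells inside both []a, b[] and the [h]-neighbourhood of [c]. *)
Lemma local_poly_approx (a b c h S E : R) n (u v : R -> R) ql qr :
  0 < h -> a + h <= c -> c <= b - h ->
  mu.-integrable `]a, b[ (EFin \o u) ->
  mu.-integrable `]a, b[ (EFin \o v) ->
  is_weak_derivative a b n u v ->
  {ae mu, forall y, `]a, b[%classic y -> `|v y| <= S} ->
  {ae mu, forall y, `]a, b[%classic y -> `|y - c| < h ->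
    `|u y - two_sided ql qr c y| <= E} ->
  exists L B : R, [/\ 0 <= L, 0 <= B & forall e : R, 0 < e -> e < h / 2 ->
    exists2 T : {poly R}, (size T <= n)%N &
      forall x, `|x - c| <= h / 2 ->
        `|T.[x] - two_sided ql qr c x|
          <= S * h ^+ n + E + (if e <= `|x - c| then L * e else B)].
Proof.
move=> h0 ac cb iu iv weak vS uE.
have [L [B [L0 B0 osc]]] := two_sided_oscillation ql qr c (ltW h0).
exists L, B; split => // e e0 eh.
have [rho [srho rho_ge0 rho0 supp]] := exists_bump e0.
pose D := `]a, b[%classic : set R.
pose m := convolve D (cst 1) rho c.
have ab x : `|x - c| <= h / 2 -> a + e < x < b - e.
  by rewrite ler_distl => /andP[x1 x2]; apply/andP; split; lra.
have mE x : `|x - c| <= h / 2 -> convolve D (cst 1) rho x = m.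
  move=> xh; apply: (convolve_mass_cst srho e0 supp); apply: ab => //.
  by rewrite subrr normr0 divr_ge0// ltW.
have m0 : 0 < m by apply: (convolve_mass_gt0 srho rho_ge0 rho0 e0 supp); lra.
have dU x : `|x - c| <= h / 2 ->
    `|derive1n n (convolve D u rho) x| <= S * m.
  move=> xh; rewrite (derive1n_convolve_weak srho e0 supp (ab _ xh) iu weak).
  rewrite -(mE x xh) -[X in `|X|]subr0 -(mul0r (convolve D (cst 1) rho x)).
  apply: (convolve_near srho rho_ge0 e0 supp) => //.
  apply: (@filterS _ _ (ae_filter_ringOfSetsType mu) _ _ _ vS) => y vy Dy _.
  by rewrite subr0 vy.
have mD : measurable D by exact: measurable_itv.
have [T0 sT0 HT0] := taylor_poly_bound
  (smooth_convolve mD iu srho e0 supp) dU.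
(* [T0] approximates the unnormalized convolution; by [mE] one mass [m] serves for all [x] here, so
   a single scaling keeps it a polynomial. *)
exists (m^-1 *: T0).
  by rewrite (leq_trans (size_scale_leq _ _)).
move=> x xh; rewrite hornerZ.
have xhh : `|x - c| <= h by rewrite (le_trans xh)//; lra.
set w := two_sided ql qr c; set K := (if _ then _ else _).
have H1 : `|convolve D u rho x - w x * m| <= (E + K) * m.
  rewrite -(mE x xh); apply: (convolve_near srho rho_ge0 e0 supp) => //.
  apply: (@filterS _ _ (ae_filter_ringOfSetsType mu) _ _ _ uE) => y uy Dy yx.
  have yh : `|y - c| < h.
    have : `|y - c| <= `|y - x| + `|x - c|.
      by rewrite (le_trans _ (ler_normD _ _))// addrA subrK.
    by move: xh yx eh; lra.
  have -> : u y - w x = (u y - w y) + (w y - w x) by ring.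
  by rewrite (le_trans (ler_normD _ _))// lerD ?uy// /K osc// ltW.
have H2 : `|convolve D u rho x - T0.[x]| <= S * h ^+ n * m.
  rewrite (le_trans (HT0 x xh))// mulrAC ler_wpM2r ?(ltW m0)//.
  rewrite ler_wpM2l ?lerXn2r ?nnegrE ?(ltW h0)//.
  have : 0 <= S * m by apply: le_trans (dU _ xh).
  by rewrite pmulr_lge0.
have -> : m^-1 * T0.[x] - w x = (T0.[x] - w x * m) / m.
  by field; rewrite gt_eqF.
rewrite normrM normfV (gtr0_norm m0) ler_pdivrMr//.
have -> : T0.[x] - w x * m =
  (convolve D u rho x - w x * m) - (convolve D u rho x - T0.[x]) by ring.
rewrite (le_trans (ler_normB _ _))//.
have -> : (S * h ^+ n + E + K) * m = (E + K) * m + S * h ^+ n * m by ring.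
exact: lerD.
Qed.

End LocalApproximation.

(** * Bounding the quadratic form by a competitor *)

Section QBound.
Context {R : realType}.
Local Open Scope classical_set_scope.
Notation mu := (@lebesgue_measure R).
Implicit Types (q ql qr : {poly R}).

(** [A] is the bound in the bulk and [B] the extra one on the short window around the node, where
    mollification mixes the two pieces. *)
Lemma sq_L2_norm_le (a b s t A B : R) (f : R -> R) :
  a <= b -> s <= t -> 0 <= A -> 0 <= B -> continuous f ->
  (forall x, a < x < b -> f x ^+ 2 <= A + B * \1_(`[s, t]) x) ->
  fine (Lq_norm 2%:E a b f) ^+ 2 <= A * (b - a) + B * (t - s).
Proof.
move=> ab st A0 B0 cf fAB.
pose D := `]a, b[%classic : set R.
have mD : measurable D by exact: measurable_itv.
have mf : measurable_fun D f.
  by apply: measurable_funTS; exact: continuous_measurable_fun.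
have muD : (mu D = (b - a)%:E)%E.
  rewrite /D lebesgue_measure_itv/= lte_fin; case: ltP => //= ba.
  by congr EFin; move: ab ba; lra.
set N := Lq_norm _ _ _ _.
have N2 : (N `^ 2 = \int[mu]_(x in D) (f x ^+ 2)%:E)%E.
  rewrite /N /Lq_norm poweR_Lnorm// [RHS]integral_mkcond.
  apply: eq_integral => x _ /=; rewrite /patch; case: ifP => _ /=.
    by rewrite powR_mulrn// real_normK// num_real.
  by rewrite normr0 powR0.
have N2le : (N `^ 2 <= (A * (b - a) + B * (t - s))%:E)%E.
  rewrite N2.
  apply: (@le_trans _ _ (\int[mu]_(x in D)
      ((cst A%:E) x + B%:E * (\1_(`[s, t]) x)%:E))%E).
    apply: ge0_le_integral => //.
    - by move=> x _; rewrite lee_fin sqr_ge0.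
    - by apply/measurable_EFinP; exact: measurable_funX.
    - apply: emeasurable_funD => //; apply: emeasurable_funM => //.
      by apply/measurable_EFinP; apply: measurable_funTS; exact: measurable_indic.
  rewrite ge0_integralD//; last 2 first.
    - by move=> x _; rewrite /= -EFinM lee_fin mulr_ge0.
    - apply: emeasurable_funM => //.
      by apply/measurable_EFinP; apply: measurable_funTS; exact: measurable_indic.
  have -> : (\int[mu]_(x in D) cst A%:E x = (A * (b - a))%:E)%E.
    by rewrite integral_cst// EFinM; congr (_ * _)%E; exact: muD.
  rewrite ge0_integralZl//; last first.
    by apply/measurable_EFinP; apply: measurable_funTS; exact: measurable_indic.
  rewrite EFinD leeD// EFinM lee_wpmul2l// integral_indic//.
  apply: (@le_trans _ _ (mu `[s, t])).
    by rewrite le_measure ?inE//; exact: measurableI.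
  rewrite lebesgue_measure_itv/= lte_fin; case: ifP => // _.
  by rewrite lee_fin subr_ge0.
have N0 : (0 <= N)%E by exact: Lnorm_ge0.
(* An infinite norm would have an infinite square, against the real bound just obtained. *)
have Nfin : N \is a fin_num.
  rewrite ge0_fin_numE// ltey; apply/eqP => Ny; move: N2le.
  by rewrite Ny poweRyr.
rewrite -lee_fin; apply: le_trans N2le.
by rewrite -[in leRHS](fineK Nfin) poweR_EFin lee_fin powR_mulrn// fine_ge0.
Qed.

(** The Taylor expansion of the jump polynomial [J] at [c] is finite and exact; the scaling of [D k]
    supplies the factor [h ^ k] of its [k]-th term, up to the common divisor [h ^ (p + 1)]. *)
Lemma half_taylor_jump p (J : {poly R}) (c h : R) (D : 'I_p.+1 -> R) xi :
  (size J <= p.+1)%N -> h != 0 ->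
  (forall k, D k = (derivn k J).[c] / h ^+ (p.+1 - k)) ->
  half_taylor D xi = 2^-1 * (J.[c + h * xi] / h ^+ p.+1).
Proof.
move=> sJ h0 DE; rewrite /half_taylor; congr (_ * _).
rewrite (@nderiv_taylor_wide _ p.+1)//; last exact: mulrC.
rewrite mulr_suml; apply: eq_bigr => k _; rewrite DE.
rewrite nderivn_def hornerMn -[_ *+ k`!]mulr_natr exprMn.
have -> : h ^+ p.+1 = h ^+ (p.+1 - k) * h ^+ k by rewrite -exprD subnK// ltnW.
by field; rewrite !expf_neq0// pnatr_eq0 -lt0n fact_gt0.
Qed.

Lemma le_of_le_addMr (x y C r : R) : 0 < r ->
  (forall e : R, 0 < e -> e < r -> x <= y + e * C) -> x <= y.
Proof.
move=> r0 H; apply/ler_addgt0Pr => d d0.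
pose e := Num.min (r / 2) (d / (`|C| + 1)).
have C1 : 0 < `|C| + 1 by rewrite ltr_wpDl.
have e0 : 0 < e by rewrite lt_min !divr_gt0.
have er : e < r by rewrite gt_min; apply/orP; left; lra.
rewrite (le_trans (H e e0 er))// lerD2l.
rewrite (@le_trans _ _ (e * (`|C| + 1)))//.
  by rewrite ler_wpM2l ?(ltW e0)// (le_trans (ler_norm _))// lerDl.
by rewrite -ler_pdivlMr// /e ge_min lexx orbT.
Qed.

Lemma Q_le_energy p (D : 'I_p.+1 -> R) (v : {poly R}) :
  (size v <= p.+1)%N -> Q D <= Q_energy D v.
Proof.
move=> sv; apply: ge_inf; last by exists v.
by exists 0 => _ [w _ <-]; rewrite addr_ge0 ?sqr_ge0.
Qed.

Lemma sqrt_Q_le p (D : 'I_p.+1 -> R) ql qr (c h K L B : R) : 0 < h ->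
  0 <= K -> 0 <= L -> 0 <= B ->
  (size ql <= p.+1)%N -> (size qr <= p.+1)%N ->
  (forall k, D k = (derivn k (qr - ql)).[c] / h ^+ (p.+1 - k)) ->
  (forall e : R, 0 < e -> e < h / 2 ->
    exists2 T : {poly R}, (size T <= p.+1)%N &
      forall x, `|x - c| <= h / 2 ->
        `|T.[x] - two_sided ql qr c x|
          <= K + (if e <= `|x - c| then L * e else B)) ->
  h ^+ p.+1 * Num.sqrt (Q D) <= K.
Proof.
move=> h0 K0 L0 B0 sl sr DE HT.
set n := p.+1.
have hn0 : 0 < h ^+ n by rewrite exprn_gt0.
suff QK : Q D <= (K / h ^+ n) ^+ 2.
  rewrite mulrC -ler_pdivlMr//.
  rewrite -[leRHS]ger0_norm ?divr_ge0 ?(ltW hn0)// -sqrtr_sqr.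
  by rewrite ler_wsqrtr.
have h20 : 0 < h / 2 by rewrite divr_gt0.
(* The first summand comes from [(K + L e) ^ 2 <= K ^ 2 + e (2 K L + L ^ 2 h)], valid as [e <= h].
   The second is the window term: each half interval is charged the full window length [2 e / h]. *)
pose C := ((2 * K * L + L ^+ 2 * h) + 4 * (K + B) ^+ 2 / h) / (h ^+ n) ^+ 2.
apply: (@le_of_le_addMr _ _ C _ h20) => e e0 eh.
have [T sT TE] := HT e e0 eh.
(* Subtracting the average of the pieces is the right choice: since [half_taylor D] is the rescaled
   [(qr - ql) / 2], adding it leaves [T - ql] on the left and subtracting it leaves [T - qr] on the
   right. *)
pose V := T - 2^-1 *: (ql + qr).
have sV : (size V <= n)%N.
  rewrite (leq_trans (size_polyD _ _))// geq_max sT size_polyN.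
  rewrite (leq_trans (size_scale_leq _ _))// (leq_trans (size_polyD _ _))//.
  by rewrite geq_max sl sr.
pose v := (h ^+ n)^-1 *: (V \Po (h *: 'X + c%:P)).
have sv : (size v <= n)%N.
  rewrite (leq_trans (size_scale_leq _ _))// size_comp_poly2// size_addl.
    by rewrite size_scale ?gt_eqF// size_polyX.
  by rewrite size_scale ?gt_eqF// size_polyX (leq_ltn_trans (size_polyC_leq1 _)).
have vE xi : v.[xi] = (T.[c + h * xi]
    - 2^-1 * (ql.[c + h * xi] + qr.[c + h * xi])) / h ^+ n.
  by rewrite /v hornerZ horner_comp /V !hornerE mulrC [h * xi + c]addrC.
have htE xi : half_taylor D xi =
    2^-1 * ((qr.[c + h * xi] - ql.[c + h * xi]) / h ^+ n).
  have sJ : (size (qr - ql)%R <= p.+1)%N.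
    by rewrite (leq_trans (size_polyD _ _))// geq_max sr size_polyN.
  by rewrite (half_taylor_jump _ sJ _ DE) ?gt_eqF// !hornerE.
have cht : continuous (half_taylor D).
  have -> : half_taylor D =
      horner ((2^-1 / h ^+ n) *: ((qr - ql) \Po (h *: 'X + c%:P))).
    apply/funext => xi; rewrite htE hornerZ horner_comp.
    rewrite !(hornerD, hornerN, hornerZ, hornerX, hornerC).
    by rewrite [h * xi + c]addrC; ring.
  exact: continuous_horner.
pose A1 := ((K + L * e) / h ^+ n) ^+ 2.
pose A2 := ((K + B) / h ^+ n) ^+ 2.
have A10 : 0 <= A1 by exact: sqr_ge0.
have A20 : 0 <= A2 by exact: sqr_ge0.
have key xi : - 2^-1 < xi < 2^-1 ->
    ((T.[c + h * xi] - two_sided ql qr c (c + h * xi)) / h ^+ n) ^+ 2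
    <= A1 + A2 * \1_(`[- (e / h), e / h]) xi.
  move=> /andP[xi1 xi2].
  have cx : c + h * xi - c = h * xi by ring.
  have nh : `|h * xi| = h * `|xi| by rewrite normrM gtr0_norm.
  have xh : `|c + h * xi - c| <= h / 2.
    by rewrite cx nh ler_wpM2l ?(ltW h0)// ler_norml; apply/andP; split; lra.
  have := TE _ xh; set g := _ - two_sided _ _ _ _ => gK.
  have sq k : `|g| <= k -> (g / h ^+ n) ^+ 2 <= (k / h ^+ n) ^+ 2.
    move=> gk; rewrite !exprMn ler_wpM2r ?sqr_ge0// -real_normK ?num_real//.
    by rewrite lerXn2r ?nnegrE// (le_trans _ gk).
  move: gK; rewrite cx nh; case: ifPn => [_ /sq H|].
    by rewrite (le_trans H)// lerDl mulr_ge0.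
  rewrite -ltNge => hxe /sq H; rewrite indicE mem_set ?mulr1.
    by rewrite (le_trans H)// lerDr.
  rewrite /= in_itv/= -ler_norml ler_pdivlMr// mulrC.
  exact: ltW.
have eh2 : - (e / h) <= e / h.
  by rewrite ge0_cp// divr_ge0// ltW.
apply: le_trans (Q_le_energy D sv) _.
have E1 : fine (Lq_norm 2%:E (- 2^-1) 0 (fun xi => v.[xi] + half_taylor D xi)) ^+ 2
    <= A1 * (0 - (- 2^-1)) + A2 * (e / h - - (e / h)).
  apply: sq_L2_norm_le => //.
  - by move=> xi; apply: cvgD; [exact: continuous_horner|exact: cht].
  - move=> xi /andP[xi1 xi2]; have := key xi; rewrite /two_sided.
    have -> : c + h * xi < c by rewrite gtrDl pmulr_rlt0.
    rewrite vE htE => H; apply: le_trans (H _); last by apply/andP; split; lra.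
    rewrite le_eqVlt; apply/orP; left; apply/eqP; congr (_ ^+ 2).
    by field; rewrite gt_eqF.
have E2 : fine (Lq_norm 2%:E 0 2^-1 (fun xi => v.[xi] - half_taylor D xi)) ^+ 2
    <= A1 * (2^-1 - 0) + A2 * (e / h - - (e / h)).
  apply: sq_L2_norm_le => //.
  - by move=> xi; apply: cvgB; [exact: continuous_horner|exact: cht].
  - move=> xi /andP[xi1 xi2]; have := key xi; rewrite /two_sided.
    have -> : (c + h * xi < c) = false.
      by apply/negbTE; rewrite -leNgt lerDl mulr_ge0// ltW.
    rewrite vE htE => H; apply: le_trans (H _); last by apply/andP; split; lra.
    rewrite le_eqVlt; apply/orP; left; apply/eqP; congr (_ ^+ 2).
    by field; rewrite gt_eqF.
apply: le_trans (lerD E1 E2) _.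
(* The two half intervals have total length 1, so [A1] enters with coefficient exactly 1. *)
have -> : A1 * (0 - - 2^-1) + A2 * (e / h - - (e / h)) +
  (A1 * (2^-1 - 0) + A2 * (e / h - - (e / h))) = A1 + A2 * (4 * e / h).
  by field; rewrite gt_eqF.
have -> : (K / h ^+ n) ^+ 2 + e * C =
    (K ^+ 2 + e * (2 * K * L + L ^+ 2 * h)) / (h ^+ n) ^+ 2 + A2 * (4 * e / h).
  by rewrite /C /A2; field; rewrite !gt_eqF.
rewrite lerD2r /A1 exprMn exprVn ler_wpM2r ?invr_ge0 ?sqr_ge0//.
have : L ^+ 2 * e * e <= L ^+ 2 * e * h.
  by rewrite ler_wpM2l ?mulr_ge0 ?sqr_ge0 ?(ltW e0)//; lra.
lra.
Qed.

End QBound.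

(** * One-sided derivatives of piecewise polynomials *)

Section Jumps.
Context {R : realType}.
Local Open Scope classical_set_scope.
Implicit Types (w : R -> R) (q ql qr : {poly R}).

Lemma derive1n_piece w q (l r : R) k : {in `]l, r[%R, w =1 horner q} ->
  {in `]l, r[%R, derive1n k w =1 horner (derivn k q)}.
Proof.
move=> wq; elim: k => [|k IH] x xlr; first exact: wq.
rewrite derive1nS derive1E derivnS derivE derive1E; apply: near_eq_derive.
by near=> y; apply: IH; near: y; exact: near_in_itvoo.
Unshelve. all: end_near. Qed.

(** The limit is taken through points of the open cell, where the [k]-th derivative is that of [q],
    a function continuous at [c]. *)
Lemma right_deriv_piece w q (c r : R) k : c < r ->
  {in `]c, r[%R, w =1 horner q} -> right_deriv k w c = (derivn k q).[c].
Proof.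
move=> cr wq; apply/cvg_lim => //.
apply: (@cvg_trans _ (horner (derivn k q) y @[y --> c^'+])); last first.
  by apply: cvg_at_right_filter; exact: continuous_horner.
apply: near_eq_cvg; near=> y; apply/esym/(derive1n_piece k wq).
rewrite in_itv/=; apply/andP; split; near: y; first exact: nbhs_right_gt.
exact: nbhs_right_lt.
Unshelve. all: end_near. Qed.

Lemma left_deriv_piece w q (l c : R) k : l < c ->
  {in `]l, c[%R, w =1 horner q} -> left_deriv k w c = (derivn k q).[c].
Proof.
move=> lc wq; apply/cvg_lim => //.
apply: (@cvg_trans _ (horner (derivn k q) y @[y --> c^'-])); last first.
  by apply: cvg_at_left_filter; exact: continuous_horner.
apply: near_eq_cvg; near=> y; apply/esym/(derive1n_piece k wq).
rewrite in_itv/=; apply/andP; split; near: y; first exact: nbhs_left_gt.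
exact: nbhs_left_lt.
Unshelve. all: end_near. Qed.

End Jumps.

(** * The sup norm as an almost everywhere bound *)

Section LinftyNorm.
Context {R : realType}.
Local Open Scope classical_set_scope.
Notation mu := (@lebesgue_measure R).
Implicit Types (f : R -> R).

Lemma Linfty_norm_ae (a b M : R) f : (Lq_norm +oo a b f <= M%:E)%E ->
  {ae mu, forall x, `]a, b[%classic x -> `|f x| <= M}.
Proof.
rewrite /Lq_norm unlock.
(* The norm of exponent [+oo] is an essential supremum only on a space of positive measure. *)
have -> : (0 < mu setT)%E.
  rewrite -set_itvNyy lebesgue_measure_itv/=. by rewrite ?ltNyy ?ltNyr ?ltry.
move/ess_supP => H.
apply: (@filterS _ _ (ae_filter_ringOfSetsType mu) _ _ _ H) => x + xab.
by rewrite /= patchE mem_set.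
Qed.

Lemma Linfty_integrable (a b : R) f : measurable_fun `]a, b[ f ->
  (Lq_norm +oo a b f < +oo)%E -> mu.-integrable `]a, b[ (EFin \o f).
Proof.
move=> mf foo.
have ffin : Lq_norm +oo a b f \is a fin_num by rewrite ge0_fin_numE// Lnorm_ge0.
have := @Linfty_norm_ae a b (fine (Lq_norm +oo a b f)) f.
rewrite fineK// lexx => /(_ isT); apply: ae_le_integrable => //.
apply: measurable_bounded_integrable => //; last exact: bounded_cst.
by rewrite /= lebesgue_measure_itv/=; case: ifP => // _; rewrite -EFinB ltry.
Qed.

End LinftyNorm.

(** * The estimate at one interior node *)

Section NodeEstimate.
Context {R : realType}.
Local Open Scope classical_set_scope.
Notation mu := (@lebesgue_measure R).

Lemma node_estimate (a b S E : R) p N i (u v w : R -> R) :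
  a < b -> (0 < i)%N -> (i < N)%N -> 0 <= S -> 0 <= E ->
  mu.-integrable `]a, b[ (EFin \o u) ->
  mu.-integrable `]a, b[ (EFin \o v) ->
  is_weak_derivative a b p.+1 u v ->
  {ae mu, forall y, `]a, b[%classic y -> `|v y| <= S} ->
  piecewise_poly p a b N w ->
  {ae mu, forall y, `]a, b[%classic y -> `|u y - w y| <= E} ->
  mesh_size a b N ^+ p.+1 * Num.sqrt (Q (@scaled_jump R p a b N w i))
    <= S * mesh_size a b N ^+ p.+1 + E.
Proof.
move=> ab i0 iN S0 E0 iu iv weak vS ww uE.
set h := mesh_size a b N; set c := node a b N i.
have N0 : (0 : R) < N%:R by rewrite ltr0n (leq_ltn_trans _ iN).
have h0 : 0 < h by rewrite divr_gt0// subr_gt0.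
have nodeS j : node a b N j.+1 = node a b N j + h.
  by rewrite /node -/h -natr1; ring.
(* The cell to the left of node [i] has index [i - 1], a true predecessor because [0 < i]. *)
have [ql sl wl] := ww i.-1 (leq_ltn_trans (leq_pred _) iN).
have [qr sr wr] := ww i iN.
have cE : c = node a b N i.-1 + h by rewrite -nodeS prednK.
rewrite prednK// -/c in wl; rewrite nodeS -/c in wr.
have ac : a + h <= c.
  rewrite cE lerD2r /node lerDl mulr_ge0// ltW//.
have cb : c <= b - h.
  rewrite lerBrDr -nodeS /node -lerBrDl.
  have -> : b - a = N%:R * h by rewrite /h /mesh_size; field; rewrite gt_eqF.
  by rewrite ler_wpM2r ?(ltW h0)// ler_nat.
have lc : node a b N i.-1 < c by rewrite cE ltrDl.
have cr : c < c + h by rewrite ltrDl.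
have uw : {ae mu, forall y, `]a, b[%classic y -> `|y - c| < h ->
    `|u y - two_sided ql qr c y| <= E}.
  (* The spline may take any value at [c], so this point is discarded as a null set. *)
  have cN : {ae mu, forall y, y != c}.
    exists [set c]; split => //; first exact: lebesgue_measure_set1.
    by move=> y /= /negP; rewrite negbK => /eqP.
  apply: (@filterS2 _ _ (ae_filter_ringOfSetsType mu) _ _ _ _ uE cN).
  move=> y uy yc Dy; rewrite ltr_distl => /andP[y1 y2].
  rewrite (le_trans _ (uy Dy))//.
  rewrite /two_sided; case: ltP => ycl.
    by rewrite wl// in_itv/= ycl andbT; move: cE y1; lra.
  by rewrite wr// in_itv/= y2 andbT lt_neqAle eq_sym yc.
have [L [B [L0 B0 H]]] := local_poly_approx h0 ac cb iu iv weak vS uw.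
apply: (sqrt_Q_le h0 _ L0 B0 sl sr (c := c)) => //.
- by rewrite addr_ge0// mulr_ge0// exprn_ge0// ltW.
- move=> k; rewrite /scaled_jump /jump -/c -/h.
  rewrite (right_deriv_piece k cr wr) (left_deriv_piece k lc wl).
  by rewrite derivnB hornerD hornerN.
Qed.

End NodeEstimate.

Theorem theorem2p5 (R : realType) (a b : R) (p : nat) (hab : a < b) :
  exists2 Cinfty : R, 0 < Cinfty &
    forall (N : nat) (u uR : R -> R), (2 <= N)%N ->
      Sobolev_infty p.+1 a b u ->
      piecewise_poly p a b N uR ->
      ((mesh_size a b N ^+ p.+1)%:E *
         ((max_sqrt_Q p a b N uR)%:E
            - Cinfty%:E * Sobolev_infty_seminorm p.+1 a b u)
       <= Lq_norm +oo a b (fun x => u x - uR x)%R)%E.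
Proof.
exists 1 => // N u uR N2 [[u_meas u_fin] uS] uRp.
have h0 : 0 < mesh_size a b N.
  by rewrite divr_gt0 ?subr_gt0// ltr0n (leq_trans _ N2).
have hp0 : 0 < mesh_size a b N ^+ p.+1 by rewrite exprn_gt0.
rewrite mul1e /Sobolev_infty_seminorm.
set v := weak_derivative a b p.+1 u.
(* The representative picked by [xget] is a genuine weak derivative, since membership in the Sobolev
   space provides one. *)
have weak : is_weak_derivative a b p.+1 u v.
  have [v' [v'w _]] := uS p.+1 (leqnn _).
  exact: (@xgetPex _ (cst 0) [set v | is_weak_derivative a b p.+1 u v]
    (ex_intro _ v' v'w)).
have mv : measurable_fun `]a, b[ v by case: weak => _ [].
have E0 : (0 <= Lq_norm +oo a b (fun x => u x - uR x)%R)%E by exact: Lnorm_ge0.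
have S0 : (0 <= Lq_norm +oo a b v)%E by exact: Lnorm_ge0.
(* An infinite error norm makes the claim trivial; an infinite seminorm makes the left side
   [-oo]. *)
case Ee : (Lq_norm +oo a b (fun x => u x - uR x)%R) E0 => [E| |]// E0;
  last by rewrite leey.
case Se : (Lq_norm +oo a b v) S0 => [S| |]// S0; last first.
  by rewrite /= gt0_muleNy// leNye.
rewrite -EFinB -EFinM lee_fin; rewrite lee_fin in E0; rewrite lee_fin in S0.
rewrite mulrBr lerBlDl mulrC -ler_pdivlMr//.
rewrite /max_sqrt_Q big_nat.
apply: (big_ind (fun y => y <=
  (mesh_size a b N ^+ p.+1 * S + E) / mesh_size a b N ^+ p.+1)).
(* The starting value 0 of the maximum must obey the bound as well. *)
- by rewrite divr_ge0 ?(ltW hp0)// addr_ge0// mulr_ge0// ltW.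
- by move=> x y xK yK; rewrite ge_max xK.
move=> i /andP[i0 iN].
rewrite ler_pdivlMr// mulrC [_ * S]mulrC.
apply: (node_estimate (u := u) (v := v) hab i0 iN S0 E0) => //.
- exact: Linfty_integrable.
- by apply: Linfty_integrable => //; rewrite Se ltry.
- by apply: Linfty_norm_ae; rewrite Se.
- by apply: Linfty_norm_ae; rewrite Ee.
Qed.
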